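(* For every integer $k\ge 0$ there exist linear operators $\alpha_k,\beta_k,\gamma_k$ on $\mathcal{P}_n$ (independent of $x$) such that $$x\,\mathbf{P}_k(x)=\mathbf{P}_{k+1}(x)\,\alpha_k+\mathbf{P}_k(x)\,\beta_k+\mathbf{P}_{k-1}(x)\,\gamma_k$$ for all $x$ (products being compositions of operators on $\mathcal{P}_n$, and $\mathbf{P}_{-1}:=0$), where in particular $$\alpha_k=(D_1+2k+1)^{-1}(D_1+2k+2)^{-1}(D_1+k+1).$$
   Context: Let $d\ge1$ and let $A,B$ be $d\times d$ complex matrices such that (i) $A+B$ is diagonalizable, and (ii) (nonresonance) the eigenvalues $\lambda_1,\dots,\lambda_d$ of $A+B$ (listed with multiplicity), with $\boldsymbol{\lambda}=(\lambda_1,\dots,\lambda_d)$, satisfy $\mathbf{m}\cdot\boldsymbol{\lambda}-\lambda_j\notin\mathbb{Z}_-=\{-1,-2,-3,\dots\}$ for all $\mathbf{m}\in\mathbb{N}^d$ and $j=1,\dots,d$, where $\mathbb{N}=\{0,1,2,\dots\}$. Put $M(x)=\frac{1}{x-1}A+\frac{1}{x+1}B$, $M_1=A+B$, $M_2=A-B$, $Q(x)=x^2-1$. Let $Y$ be a fundamental matrix of solutions of $\mathbf{y}'=M\mathbf{y}$ (so $Y'=MY$, $Y$ invertible), taken locally near a point $x\in\mathbb{C}\setminus\{\pm1\}$. For $n\in\mathbb{N}$, let $\mathcal{P}_n$ be the space of $\mathbb{C}^d$-valued polynomials $\mathbf{q}(\mathbf{w})$ in $\mathbf{w}=(w_1,\dots,w_d)$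 that are homogeneous of degree $n$. For $k\ge0$ the linear operator $\mathbf{P}_k(x)$ on $\mathcal{P}_n$ is defined by $$\mathbf{P}_k(x)\mathbf{q}(\mathbf{w})=Y(x)\,\frac{d^k}{dt^k}\Big|_{t=x}\left[Q(t)^k\,Y^{-1}(t)\,\mathbf{q}\left(Y(t)Y^{-1}(x)\mathbf{w}\right)\right];$$ it is a polynomial in $x$ with coefficients linear operators on $\mathcal{P}_n$. Define the linear operator $D_1$ on $\mathcal{P}_n$ by $D_1\mathbf{q}(\mathbf{w})=\mathrm{d}\mathbf{q}(\mathbf{w})\,M_1\mathbf{w}-M_1\mathbf{q}(\mathbf{w})$, where $\mathrm{d}\mathbf{q}(\mathbf{w})$ is the Jacobian matrix of $\mathbf{q}$ in $\mathbf{w}$. In $D_1+c$ with a number $c$, $c$ stands for $c$ times the identity. *)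

(* Defs.v *)
From HB Require Import structures.
From mathcomp Require Import all_boot all_order all_algebra.
From mathcomp Require Import complex.
From mathcomp Require Import all_classical all_reals all_analysis.
(* A plain import fails: the notations of mpoly clash with all_analysis. *)
From mathcomp Require Import (coercions, canonicals) mpoly.

Set Implicit Arguments.
Unset Strict Implicit.
Unset Printing Implicit Defensive.

Import Order.TTheory GRing.Theory Num.Theory.
Import numFieldNormedType.Exports.

Local Open Scope classical_set_scope.
Local Open Scope ring_scope.

(* R[i], seen as a numFieldType so that the topology and the normed-module
   structure carried by every numFieldType are found on it. Derivatives of
   functions Cplx R -> Cplx R are then complex derivatives. *)
Definition Cplx (R : realType) : numFieldType := R[i].

Definition Pn (K : fieldType) (d n : nat) :=
  {ffun 'I_d.+1 -> mpoly.dhomog d.+1 K n}.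

Definition pn_eval (K : fieldType) (d n : nat) (q : Pn K d n)
    (w : 'cV[K]_d.+1) : 'cV[K]_d.+1 :=
  \col_i mpoly.meval (fun j => w j 0) (q i).

(* The j-th coordinate of the vector polynomial w |-> L w. *)
Definition linform (K : fieldType) (d : nat) (L : 'M[K]_d.+1) (j : 'I_d.+1) :
    mpoly.mpoly d.+1 K :=
  \sum_l L j l *: mpoly.mpolyX K (mpoly.mnm1 l).

Definition lie_poly (K : fieldType) (d n : nat) (L : 'M[K]_d.+1)
    (q : Pn K d n) (i : 'I_d.+1) : mpoly.mpoly d.+1 K :=
  \sum_j mpoly.mderiv j (q i) * linform L j
  - \sum_j L i j *: (q j : mpoly.mpoly d.+1 K).

Lemma mderiv_lin_homog (K : fieldType) (d n : nat) (j : 'I_d.+1)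
    (p q : mpoly.mpoly d.+1 K) :
  p \is mpoly.ishomog1 n mpoly.mdeg -> q \is mpoly.ishomog1 1 mpoly.mdeg ->
  mpoly.mderiv j p * q \is mpoly.ishomog1 n mpoly.mdeg.
Proof.
move=> hp hq; case: n hp => [|n] hp.
  suff -> : mpoly.mderiv j p = 0 by rewrite mul0r mpoly.dhomog0.
  apply/mpoly.mpolyP => m; rewrite mpoly.mcoeff0 mpoly.mcoeff_deriv.
  rewrite (mpoly.dhomog_nemf_coeff hp) ?mul0rn //.
  by rewrite /= mpoly.mdegD mpoly.mdeg1 addn1.
rewrite -(addn1 n); apply: mpoly.dhomogM hq; apply/mpoly.dhomogP => m.
rewrite mpoly.mcoeff_msupp mpoly.mcoeff_deriv => nz; apply/eqP.
apply: contraNT nz => ne.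
rewrite (mpoly.dhomog_nemf_coeff hp) ?mul0rn //.
by rewrite /= mpoly.mdegD mpoly.mdeg1 addn1 eqSS.
Qed.

Lemma lie_poly_homog (K : fieldType) (d n : nat) (L : 'M[K]_d.+1)
    (q : Pn K d n) (i : 'I_d.+1) :
  lie_poly L q i \is mpoly.ishomog1 n mpoly.mdeg.
Proof.
apply: rpredB; apply: rpred_sum => j _.
  apply: mderiv_lin_homog; first exact: mpoly.dhomog_is_dhomog.
  apply: rpred_sum => l _; apply: rpredZ.
  by rewrite mpoly.dhomogX /= mpoly.mdeg1.
by apply: rpredZ; exact: mpoly.dhomog_is_dhomog.
Qed.

Definition lie_fun (K : fieldType) (d n : nat) (L : 'M[K]_d.+1)
    (q : Pn K d n) : Pn K d n :=
  [ffun i => mpoly.DHomog (lie_poly_homog L q i)].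

Lemma lie_fun_is_linear (K : fieldType) (d n : nat) (L : 'M[K]_d.+1) :
  linear (@lie_fun K d n L).
Proof.
move=> c p q; apply/ffunP => i; rewrite !ffunE; apply: val_inj => /=.
rewrite /lie_poly scalerBr !scaler_sumr addrACA -opprD -!big_split /=.
congr (_ - _); apply: eq_bigr => j _.
  by rewrite !ffunE /= mpoly.mderivD mpoly.mderivZ mulrDl scalerAl.
by rewrite !ffunE /= scalerDr !scalerA mulrC.
Qed.

HB.instance Definition _ (K : fieldType) (d n : nat) (L : 'M[K]_d.+1) :=
  GRing.isLinear.Build K (Pn K d n) (Pn K d n) *:%R (lie_fun L)
    (lie_fun_is_linear L).

(* q |-> dq(w) L w - L q(w) *)
Definition lie_op (K : fieldType) (d n : nat) (L : 'M[K]_d.+1) :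
  'End(Pn K d n) := linfun (@lie_fun K d n L).

Definition Mcoef (R : realType) (d : nat) (A B : 'M[Cplx R]_d.+1)
    (x : Cplx R) : 'M[Cplx R]_d.+1 :=
  (x - 1)^-1 *: A + (x + 1)^-1 *: B.

Definition fundamental_near (R : realType) (d : nat)
    (A B : 'M[Cplx R]_d.+1) (x : Cplx R) (Y : Cplx R -> 'M[Cplx R]_d.+1) :
    Prop :=
  \forall t \near x, Y t \in unitmx /\
    forall i j, is_derive t (1 : Cplx R) (fun s => Y s i j)
                  ((Mcoef A B t *m Y t) i j).

(* The value at w of P_k(x) q, computed with the fundamental matrix Y. *)
Definition rodrigues (R : realType) (d n k : nat)
    (Y : Cplx R -> 'M[Cplx R]_d.+1) (x : Cplx R) (q : Pn (Cplx R) d n)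
    (w : 'cV[Cplx R]_d.+1) : 'cV[Cplx R]_d.+1 :=
  Y x *m \col_i derive1n k
    (fun t => ((t ^+ 2 - 1) ^+ k *:
       (invmx (Y t) *m pn_eval q (Y t *m invmx (Y x) *m w))) i 0) x.

Definition polynomial_in (K : fieldType) (V : lmodType K) (F : K -> V) : Prop :=
  exists s : seq V, forall x, F x = \sum_(i < size s) x ^+ i *: s`_i.

(* P k x is P_k(x): the operator-valued polynomial in x whose value at each
   x other than 1 and -1 is given by the Rodrigues formula. As fundamental
   matrices exist near every such x, this determines P k on all of C,
   including at x = 1 and x = -1. *)
Definition is_rodrigues_family (R : realType) (d n : nat)
    (A B : 'M[Cplx R]_d.+1) (P : nat -> Cplx R -> 'End(Pn (Cplx R) d n)) :
    Prop :=
  forall k, polynomial_in (P k) /\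
    forall x Y, x != 1 -> x != -1 -> fundamental_near A B x Y ->
      forall q w, pn_eval (P k x q) w = rodrigues k Y x q w.

Definition nonresonant (R : realType) (d : nat)
    (lam : 'I_d.+1 -> Cplx R) : Prop :=
  forall (m : 'I_d.+1 -> nat) (j : 'I_d.+1) (z : int), (z < 0)%R ->
    \sum_i (m i)%:R * lam i - lam j != z%:~R.

(* D + c *)
Definition op_shift (K : fieldType) (V : vectType K) (D : 'End(V)) (c : nat) :
  'End(V) := (D + c%:R *: \1)%VF.

(* Main.v *)
Require Import Defs.
From HB Require Import structures.
From mathcomp Require Import all_boot all_order all_algebra.
From mathcomp Require Import complex.
From mathcomp Require Import all_classical all_reals all_analysis.
From mathcomp Require Import (coercions, canonicals) mpoly.

Set Implicit Arguments.
Unset Strict Implicit.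
Unset Printing Implicit Defensive.

Import Order.TTheory GRing.Theory Num.Theory.
Import numFieldNormedType.Exports.

Local Open Scope classical_set_scope.
Local Open Scope ring_scope.

(** Write D_L for the operator q |-> dq(w) L w - L q(w), and put D1 = D_(A+B),
    D2 = D_(A-B), Q = x^2 - 1 and nabla = d/dx + (x D1 + D2) / Q. If q_t is a
    vector polynomial depending on t, the equation Y' = M Y gives
      d/dt [Y^-1 q_t (Y u)] = Y^-1 (nabla q_t) (Y u),
    so that P_k = nabla^k Q^k on polynomials that are constant in t
    (derive1n_pullback). The poles cancel because nabla Q^j = Q^(j-1) T_j with
    T_j = Q d/dx + 2 j x + x D1 + D2; hence P_k = T_1 ... T_k, which is a
    polynomial in x and serves as its definition below (rodrigues_op).

    The recurrence is a computation with the Weyl relation [d/dx, x] = 1. Let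
    R_k = nabla^k Q^k x and S_k = nabla^k Q^(k+1), applied to the constant
    identity operator, and N_c = D1 + c. Differentiating one factor gives
      P_(k+1) = R_k N_(2k+2) + P_k D2,
      R_(k+1) = S_k N_(2k+3) + P_k N_(2k+2) + R_k D2,
    and commuting x through nabla^(k+1) gives
      R_(k+1) = x P_(k+1) + (k+1) S_k
    (rodS, rodXS, rodX_mulX). Constants multiply on the right because nabla
    acts by composition on the left. Once every N_c with c > 0 is invertible,
    R_k and S_k can be eliminated and x P_k becomes a combination of P_(k+1),
    P_k and P_(k-1) (rod_recurrence); the coefficient of P_(k+1) is
    N_(2k+2)^-1 (1 - k N_(2k+1)^-1), that is N_(2k+2)^-1 N_(2k+1)^-1 N_(k+1).

    Invertibility is where diagonalizability and nonresonance enter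
    (lker_op_shift_eq0): in coordinates diagonalizing A + B, the operator D1 is
    diagonal, with eigenvalues m . lambda - lambda_j on the monomials. *)

(** * Twisted derivations in a module over the Weyl algebra *)

Section WeylModule.
Variables (W : zmodType) (X d D1 D2 : {additive W -> W}).

Definition mulQ (F : W) : W := X (X F) - F.

(** The operator T_j: in nabla (Q^j F) = Q^(j-1) T_j F it absorbs both the
    derivative of Q^j and the denominator of nabla. *)
Definition twisted_deriv (j : nat) (F : W) : W :=
  mulQ (d F) + X F *+ (2 * j) + X (D1 F) + D2 F.

(** nabla^k Q^k, as T_1 ... T_k; the factor Q^k meets T_k first. *)
Fixpoint rodrigues_op (k : nat) (F : W) : W :=
  if k is k'.+1 then rodrigues_op k' (twisted_deriv k F) else F.

Fact mulQ_additive : additive mulQ.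
Proof. by move=> F G; rewrite /mulQ !raddfB /= addrACA. Qed.
HB.instance Definition _ := GRing.isZmodMorphism.Build W W mulQ mulQ_additive.

Fact twisted_deriv_additive j : additive (twisted_deriv j).
Proof.
move=> F G; rewrite /twisted_deriv !raddfB /= mulrnBl !opprD.
by do 2![rewrite [RHS]addrACA; congr (_ + _)]; rewrite [RHS]addrACA.
Qed.
HB.instance Definition _ j :=
  GRing.isZmodMorphism.Build W W (twisted_deriv j) (twisted_deriv_additive j).

Fact rodrigues_op_additive k : additive (rodrigues_op k).
Proof. by elim: k => //= k IH F G; rewrite raddfB IH. Qed.
HB.instance Definition _ k :=
  GRing.isZmodMorphism.Build W W (rodrigues_op k) (rodrigues_op_additive k).

Hypothesis dX : forall F, d (X F) = X (d F) + F.
Hypothesis D1X : forall F, D1 (X F) = X (D1 F).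
Hypothesis D2X : forall F, D2 (X F) = X (D2 F).

(** mulQ is itself a difference, and rewriting with raddfD alone would split
    it too. *)
Let raddf4 (f : {additive W -> W}) a b c e :
  f (a + b + c + e) = f a + f b + f c + f e.
Proof. by rewrite !(raddfD f). Qed.

Lemma mulQ_X F : mulQ (X F) = X (mulQ F).
Proof. by rewrite /mulQ (raddfB X). Qed.

Lemma twisted_derivX j F :
  twisted_deriv j (X F) = X (twisted_deriv j F) + mulQ F.
Proof.
rewrite /twisted_deriv dX D1X D2X (raddfD mulQ) /= mulQ_X.
rewrite (raddf4 X) (raddfMn X); move: (mulQ F) (mulQ (d F)) => q p.
by rewrite -!addrA; congr (_ + _); rewrite addrC -!addrA.
Qed.

(** Both sides are Q^(-j) nabla Q^(j+1) F multiplied by Q. *)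
Lemma twisted_deriv_mulQ j F :
  twisted_deriv j (mulQ F) = mulQ (twisted_deriv j.+1 F).
Proof.
have dQ : d (mulQ F) = mulQ (d F) + X F *+ 2.
  rewrite {1}/mulQ (raddfB d) !dX (raddfD X) /mulQ mulr2n.
  by rewrite -!addrA; congr (_ + _); rewrite addrA addrC.
have D1Q : D1 (mulQ F) = mulQ (D1 F) by rewrite /mulQ (raddfB D1) !D1X.
have D2Q : D2 (mulQ F) = mulQ (D2 F) by rewrite /mulQ (raddfB D2) !D2X.
rewrite /twisted_deriv dQ D1Q D2Q -!mulQ_X (raddf4 mulQ) (raddfD mulQ).
rewrite !(raddfMn mulQ) /=.
move: (mulQ (mulQ _)) (mulQ (X F)) => q p.
by congr (_ + _ + _); rewrite mulnS (mulrnDr _ 2 (2 * j)) -addrA.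
Qed.

(** The commutator [nabla^(k+1), x] = (k+1) nabla^k, applied to Q^(k+1) F. *)
Lemma rodrigues_opX k F : rodrigues_op k.+1 (X F) =
  X (rodrigues_op k.+1 F) + rodrigues_op k (mulQ F) *+ k.+1.
Proof.
elim: k F => [|k IH] F; first by rewrite /= twisted_derivX mulr1n.
rewrite -[LHS]/(rodrigues_op k.+1 (twisted_deriv k.+2 (X F))).
rewrite twisted_derivX (raddfD (rodrigues_op _)) /=.
rewrite -[rodrigues_op k _]/(rodrigues_op k.+1 (X _)) IH.
by rewrite -twisted_deriv_mulQ -addrA -mulrSr.
Qed.

Lemma twisted_deriv_const j c : d c = 0 ->
  twisted_deriv j c = X (D1 c + c *+ (2 * j)) + D2 c.
Proof.
move=> dc; rewrite /twisted_deriv dc (raddf0 mulQ) add0r (raddfD X) (raddfMn X).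
by rewrite [X _ *+ _ + _]addrC.
Qed.

(** The term x^2 that arises here is split as Q + 1, so that the Q part is
    again of the form to which rodrigues_opX applies. *)
Lemma twisted_deriv_Xconst j c : d c = 0 ->
  twisted_deriv j (X c) =
  mulQ (D1 c + c *+ (2 * j).+1) + (D1 c + c *+ (2 * j)) + X (D2 c).
Proof.
move=> dc; rewrite twisted_derivX twisted_deriv_const // (raddfD X) addrAC.
congr (_ + _); rewrite (mulrSr _ (2 * j)) (addrA (D1 c)).
move: (D1 c + c *+ _) => e; rewrite (raddfD mulQ) /= [RHS]addrAC.
by congr (_ + _); rewrite /mulQ subrK.
Qed.
End WeylModule.

(** Used to pull constant operators out on the right, and to pass from operator
    polynomials to vector polynomials by applying them to a vector. *)
Lemma rodrigues_op_morph (W W' : zmodType)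
    (X d D1 D2 : {additive W -> W}) (X' d' D1' D2' : {additive W' -> W'})
    (phi : {additive W -> W'}) :
  {morph phi : F / X F >-> X' F} -> {morph phi : F / d F >-> d' F} ->
  {morph phi : F / D1 F >-> D1' F} -> {morph phi : F / D2 F >-> D2' F} ->
  forall k, {morph phi : F / rodrigues_op X d D1 D2 k F >->
                             rodrigues_op X' d' D1' D2' k F}.
Proof.
move=> pX pd p1 p2; elim=> //= k IH F; rewrite IH; congr rodrigues_op.
by rewrite /twisted_deriv /mulQ !raddfD raddfMn raddfN /= p2 !pX p1 pd.
Qed.

(** A polynomial with coefficients in a module E is represented by its
    coefficient sequence. The Weyl relations hold for arbitrary sequences;
    finiteness of the support enters through evaluation. *)
Section CoefSequences.
Variables (K : comNzRingType) (E : lmodType K).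
Implicit Types F : nat -> E.

Definition shift_seq F : nat -> E := fun i => if i is j.+1 then F j else 0.
Definition deriv_seq F : nat -> E := fun i => F i.+1 *+ i.+1.
Definition const_seq (c : E) : nat -> E := fun i => if i is 0%N then c else 0.

Fact shift_seq_additive : additive shift_seq.
Proof. by move=> F G; apply/funext => -[|i] //=; rewrite /= !fctE /= subr0. Qed.
HB.instance Definition _ :=
  GRing.isZmodMorphism.Build _ _ shift_seq shift_seq_additive.

Fact deriv_seq_additive : additive deriv_seq.
Proof. by move=> F G; apply/funext => i; rewrite /deriv_seq !fctE mulrnBl. Qed.
HB.instance Definition _ :=
  GRing.isZmodMorphism.Build _ _ deriv_seq deriv_seq_additive.

Lemma deriv_shift_seq F :
  deriv_seq (shift_seq F) = shift_seq (deriv_seq F) + F.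
Proof.
by apply/funext => -[|i]; rewrite fctE /deriv_seq /= ?add0r // mulrSr.
Qed.

Lemma deriv_const_seq c : deriv_seq (const_seq c) = 0.
Proof. by apply/funext => i; rewrite /deriv_seq mul0rn. Qed.

Definition ev_seq (N : nat) F (x : K) : E := \sum_(i < N) x ^+ i *: F i.

Definition supp_below (N : nat) F := forall i, (N <= i)%N -> F i = 0.

Lemma ev_seq_widen N N' F x : supp_below N F -> (N <= N')%N ->
  ev_seq N' F x = ev_seq N F x.
Proof.
move=> s le; rewrite /ev_seq.
rewrite (@big_ord_widen _ _ _ N N' (fun i => x ^+ i *: F i)) //.
rewrite [RHS]big_mkcond /=; apply: eq_bigr => i _.
by case: ltnP => // h; rewrite s // scaler0.
Qed.

Lemma ev_seqD N F G x : ev_seq N (F + G) x = ev_seq N F x + ev_seq N G x.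
Proof.
by rewrite /ev_seq -big_split; apply: eq_bigr => i _; rewrite scalerDr.
Qed.

Lemma ev_seqN N F x : ev_seq N (- F) x = - ev_seq N F x.
Proof. by rewrite /ev_seq -sumrN; apply: eq_bigr => i _; rewrite scalerN. Qed.

Lemma ev_seqMn N F x k : ev_seq N (F *+ k) x = ev_seq N F x *+ k.
Proof.
elim: k => [|k IH]; last by rewrite !mulrSr ev_seqD IH.
by rewrite /ev_seq big1 // => i _; rewrite scaler0.
Qed.

Lemma ev_seq_shift N F x : ev_seq N.+1 (shift_seq F) x = x *: ev_seq N F x.
Proof.
rewrite /ev_seq big_ord_recl scaler0 add0r scaler_sumr.
by apply: eq_bigr => i _; rewrite scalerA -exprS.
Qed.

Lemma ev_seq_const N c x : ev_seq N.+1 (const_seq c) x = c.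
Proof.
rewrite /ev_seq big_ord_recl scale1r big1 ?addr0 // => i _.
by rewrite scaler0.
Qed.

Lemma supp_shift N F : supp_below N F -> supp_below N.+1 (shift_seq F).
Proof. by move=> s [|i] //= /s. Qed.

Lemma supp_deriv N F : supp_below N.+1 F -> supp_below N (deriv_seq F).
Proof. by move=> s i h; rewrite /deriv_seq s ?mul0rn. Qed.

Lemma suppD N F G : supp_below N F -> supp_below N G -> supp_below N (F + G).
Proof. by move=> sF sG i le; rewrite addrfctE sF // sG // addr0. Qed.

Lemma suppN N F : supp_below N F -> supp_below N (- F).
Proof. by move=> s i le; rewrite opprfctE s // oppr0. Qed.

Lemma suppMn N F k : supp_below N F -> supp_below N (F *+ k).
Proof. by move=> s i le; rewrite natmulfctE s // mul0rn. Qed.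

Lemma supp_const c : supp_below 1 (const_seq c).
Proof. by move=> [|i]. Qed.

Lemma suppW N N' F : (N <= N')%N -> supp_below N F -> supp_below N' F.
Proof. by move=> le s i h; apply: s; apply: leq_trans h. Qed.
End CoefSequences.

Section LiftedOperators.
Variables (K : comNzRingType) (E : lmodType K).
Implicit Types (F : nat -> E) (D : {linear E -> E}).

Definition map_seq D F : nat -> E := fun i => D (F i).

Fact map_seq_additive D : additive (map_seq D).
Proof. by move=> F G; apply/funext => i; rewrite /map_seq !fctE raddfB. Qed.
HB.instance Definition _ D :=
  GRing.isZmodMorphism.Build _ _ (map_seq D) (map_seq_additive D).

Lemma map_shift_seq D F : map_seq D (shift_seq F) = shift_seq (map_seq D F).
Proof. by apply/funext => -[|i]; rewrite /map_seq //= raddf0. Qed.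

Lemma map_const_seq D c : map_seq D (const_seq c) = const_seq (D c).
Proof. by apply/funext => -[|i]; rewrite /map_seq //= raddf0. Qed.

Lemma ev_map_seq D N F x : ev_seq N (map_seq D F) x = D (ev_seq N F x).
Proof.
by rewrite /ev_seq linear_sum; apply: eq_bigr => i _; rewrite linearZ.
Qed.

Variables D1 D2 : {linear E -> E}.

Definition twisted_seq (j : nat) F : nat -> E :=
  twisted_deriv (@shift_seq K E) (@deriv_seq K E) (map_seq D1) (map_seq D2) j F.

Definition rodrigues_seq (k : nat) F : nat -> E :=
  rodrigues_op (@shift_seq K E) (@deriv_seq K E) (map_seq D1) (map_seq D2) k F.

Fact rodrigues_seq_additive k : additive (rodrigues_seq k).
Proof. exact: rodrigues_op_additive. Qed.
HB.instance Definition _ k :=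
  GRing.isZmodMorphism.Build _ _ (rodrigues_seq k) (rodrigues_seq_additive k).

Lemma rodrigues_seqS k F :
  rodrigues_seq k.+1 F = rodrigues_seq k (twisted_seq k.+1 F).
Proof. by []. Qed.

Lemma supp_map_seq D N F : supp_below N F -> supp_below N (map_seq D F).
Proof. by move=> s i le; rewrite /map_seq s // raddf0. Qed.

Lemma supp_twisted_seq N j F :
  supp_below N.+1 F -> supp_below N.+2 (twisted_seq j F).
Proof.
move=> s; have s' : supp_below N.+2 F by apply: suppW s.
rewrite /twisted_seq /twisted_deriv; do !apply: suppD.
- by do 2!apply: supp_shift; exact: supp_deriv.
- by apply/suppN/(suppW _ (supp_deriv s)); rewrite leqW.
- exact/suppMn/supp_shift.
- exact/supp_shift/supp_map_seq.
- exact: supp_map_seq.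
Qed.

Lemma ev_twisted_seq N j F x : supp_below N.+1 F ->
  ev_seq N.+2 (twisted_seq j F) x =
  (x ^+ 2 - 1) *: ev_seq N (deriv_seq F) x
  + (x *: (ev_seq N.+1 F x *+ (2 * j) + D1 (ev_seq N.+1 F x))
     + D2 (ev_seq N.+1 F x)).
Proof.
move=> s; rewrite /twisted_seq /twisted_deriv !ev_seqD ev_seqMn ev_seqN.
rewrite !ev_seq_shift !ev_map_seq (ev_seq_widen x s (leqnSn _)).
rewrite (@ev_seq_widen _ _ N N.+2 _ x (supp_deriv s)) ?leqW //.
rewrite scalerBl scale1r scalerA -expr2 scalerDr -scalerMnr.
by rewrite -!addrA.
Qed.

Lemma supp_rodrigues_seq N k F :
  supp_below N.+1 F -> supp_below (k + N).+1 (rodrigues_seq k F).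
Proof.
elim: k N F => [|k IH] N F s //; rewrite rodrigues_seqS addSnnS.
exact/IH/supp_twisted_seq.
Qed.
End LiftedOperators.

(** * Linear vector fields acting on polynomials *)

Section LinearVectorField.
Variables (K : fieldType) (d : nat).
Implicit Types (L S T : 'M[K]_d.+1) (p r : mpoly.mpoly d.+1 K).

Definition lie_derivation L p : mpoly.mpoly d.+1 K :=
  \sum_j mpoly.mderiv j p * linform L j.

Fact lie_derivation_is_linear L : linear (lie_derivation L).
Proof.
move=> c p q; rewrite /lie_derivation scaler_sumr -big_split /=.
apply: eq_bigr => j _.
by rewrite mpoly.mderivD mpoly.mderivZ mulrDl scalerAl.
Qed.
HB.instance Definition _ L :=
  GRing.isLinear.Build K _ _ _ (lie_derivation L) (lie_derivation_is_linear L).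

Lemma lie_derivationM L p r :
  lie_derivation L (p * r) = lie_derivation L p * r + p * lie_derivation L r.
Proof.
rewrite /lie_derivation mulr_suml mulr_sumr -big_split /=.
apply: eq_bigr => j _; rewrite mpoly.mderivM mulrDl mulrA.
by rewrite mulrAC.
Qed.

Lemma lie_derivation1 L : lie_derivation L 1 = 0.
Proof.
by rewrite /lie_derivation big1 // => j _; rewrite mpoly.mderivC mul0r.
Qed.

Lemma lie_derivationXU L l :
  lie_derivation L (mpoly.mpolyX K (mpoly.mnm1 l)) = linform L l.
Proof.
rewrite /lie_derivation (bigD1 l) //= big1 => [|j jl].
  have mm : mpoly.mnm_sub (mpoly.mnm1 l) (mpoly.mnm1 l) =
      mpoly.mnm0 :> mpoly.multinom d.+1.
    by apply/mpoly.mnmP => i; rewrite mpoly.mnmBE mpoly.mnm0E subnn.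
  by rewrite addr0 mpoly.mderivX mpoly.mnm1E eqxx scale1r mm
    mpoly.mpolyX0 mul1r.
by rewrite mpoly.mderivX mpoly.mnm1E eq_sym (negPf jl) scale0r mul0r.
Qed.

(** The derivation acts on linear forms as L acts on row vectors from the
    right, so left eigenvectors of L give eigenforms. *)
Lemma lie_derivation_linform L S a :
  lie_derivation L (linform S a) = linform (S *m L) a.
Proof.
rewrite {1}/linform linear_sum /=.
under eq_bigr do rewrite linearZ /= lie_derivationXU /linform scaler_sumr.
rewrite exchange_big; apply: eq_bigr => j _ /=.
rewrite mxE scaler_suml; apply: eq_bigr => l _.
by rewrite scalerA.
Qed.

Definition eigen_for L p (c : K) := lie_derivation L p = c *: p.

Lemma eigen_for1 L : eigen_for L 1 0.
Proof. by rewrite /eigen_for lie_derivation1 scale0r. Qed.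

Lemma eigen_forM L p r a b :
  eigen_for L p a -> eigen_for L r b -> eigen_for L (p * r) (a + b).
Proof.
move=> hp hr; rewrite /eigen_for lie_derivationM hp hr.
by rewrite scalerDl scalerAl scalerAr.
Qed.

Lemma eigen_forX L p a k : eigen_for L p a -> eigen_for L (p ^+ k) (k%:R * a).
Proof.
move=> hp; elim: k => [|k IH]; first by rewrite mul0r; exact: eigen_for1.
by rewrite exprS -natr1 mulrDl mul1r addrC; apply: eigen_forM.
Qed.

Definition lin_subst S : mpoly.mpoly d.+1 K -> mpoly.mpoly d.+1 K :=
  mpoly.comp_mpoly [tuple linform S a | a < d.+1].

Lemma lin_substZ S c p : lin_subst S (c *: p) = c *: lin_subst S p.
Proof. exact: mpoly.comp_mpolyZ. Qed.

Lemma lin_subst_sum S I (s : seq I) (F : I -> mpoly.mpoly d.+1 K) :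
  lin_subst S (\sum_(i <- s) F i) = \sum_(i <- s) lin_subst S (F i).
Proof. exact: raddf_sum. Qed.

Lemma lin_subst_monom S m : lin_subst S (mpoly.mpolyX K m) =
  \prod_a linform S a ^+ m a.
Proof.
rewrite /lin_subst mpoly.comp_mpolyX; apply: eq_bigr => a _.
by rewrite tnth_mktuple.
Qed.

Lemma lin_substXU S a :
  lin_subst S (mpoly.mpolyX K (mpoly.mnm1 a)) = linform S a.
Proof.
by rewrite /lin_subst mpoly.comp_mpolyXU nth_mktuple.
Qed.

Lemma lin_subst_linform S T a : lin_subst S (linform T a) = linform (T *m S) a.
Proof.
rewrite {1}/linform lin_subst_sum.
under eq_bigr do rewrite lin_substZ lin_substXU /linform scaler_sumr.
rewrite exchange_big; apply: eq_bigr => j _ /=.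
rewrite mxE scaler_suml; apply: eq_bigr => l _.
by rewrite scalerA.
Qed.

Lemma linform1 a :
  linform (1%:M : 'M[K]_d.+1) a = mpoly.mpolyX K (mpoly.mnm1 a).
Proof.
rewrite /linform (bigD1 a) //= mxE eqxx scale1r big1 ?addr0 // => l la.
by rewrite mxE eq_sym (negPf la) scale0r.
Qed.

Lemma lin_substK S T : T *m S = 1%:M -> cancel (lin_subst T) (lin_subst S).
Proof.
move=> TS p; rewrite {1}[p]mpoly.mpolyE [RHS]mpoly.mpolyE.
rewrite (lin_subst_sum T) (lin_subst_sum S); apply: eq_bigr => m _.
rewrite !lin_substZ lin_subst_monom; congr (_ *: _).
rewrite [LHS]rmorph_prod [RHS]mpoly.mpolyXE_id; apply: eq_bigr => a _.
by rewrite rmorphXn /= -linform1 -TS -lin_subst_linform.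
Qed.

(** The rows of S are left eigenvectors of L, their linear forms are
    eigenforms, and eigenvalues of a derivation add up along products. *)
Lemma eigen_for_monom L S (D : 'rV[K]_d.+1) m : S *m L = diag_mx D *m S ->
  eigen_for L (lin_subst S (mpoly.mpolyX K m)) (\sum_a (m a)%:R * D 0 a).
Proof.
move=> SL; rewrite lin_subst_monom.
elim/big_rec2: _ => [|a s p _ IH]; first exact: eigen_for1.
apply: eigen_forM => //; apply: eigen_forX.
rewrite /eigen_for lie_derivation_linform SL /linform scaler_sumr.
apply: eq_bigr => l _; rewrite scalerA mul_diag_mx.
by rewrite mxE.
Qed.

(** After the linear change of variables S the derivation is diagonal on
    monomials; each coefficient is then multiplied by a nonzero number. *)
Lemma eigen_for_eq0 L S (D : 'rV[K]_d.+1) (mu : K) p :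
  S \in unitmx -> S *m L = diag_mx D *m S ->
  (forall m : 'I_d.+1 -> nat, \sum_a (m a)%:R * D 0 a != mu) ->
  eigen_for L p mu -> p = 0.
Proof.
move=> Su SL hmu hp.
set r := lin_subst (invmx S) p.
have rp : lin_subst S r = p by rewrite lin_substK ?mulVmx.
suff r0 : r = 0 by rewrite -rp r0 /lin_subst mpoly.comp_mpoly0.
pose wt (m : 'I_d.+1 -> nat) := \sum_a (m a)%:R * D 0 a - mu.
(* Substituting S in r' gives the derivation applied to p, minus mu p. *)
pose r' :=
  \sum_(m <- mpoly.msupp r) (wt m * mpoly.mcoeff m r) *: mpoly.mpolyX K m.
have : lin_subst S r' = 0.
  transitivity (lie_derivation L p - mu *: p); last by rewrite hp subrr.
  rewrite -rp [r]mpoly.mpolyE /r' !(lin_subst_sum S) raddf_sum scaler_sumr.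
  rewrite -sumrB /=.
  apply: eq_bigr => m _; rewrite !lin_substZ linearZ /= (eigen_for_monom _ SL).
  by rewrite !scalerA -scalerBl [mu * _]mulrC -mulrBr mulrC.
move/(congr1 (lin_subst (invmx S))); rewrite lin_substK ?mulmxV //.
rewrite /lin_subst mpoly.comp_mpoly0 => r'0.
apply/mpoly.mpolyP => m; rewrite mpoly.mcoeff0.
have [mr|] := boolP (m \in mpoly.msupp r); last first.
  by move/mpoly.memN_msupp_eq0.
have := congr1 (mpoly.mcoeff m) r'0; rewrite mpoly.mcoeff0 raddf_sum /=.
rewrite (bigD1_seq m) ?mpoly.msupp_uniq //= mpoly.mcoeffZ mpoly.mcoeffX eqxx.
rewrite big1 => [|m' m'm]; last first.
  by rewrite mpoly.mcoeffZ mpoly.mcoeffX (negPf m'm) mulr0.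
rewrite addr0 mulr1 => /eqP; rewrite mulf_eq0 subr_eq0 (negPf (hmu m)).
by move/eqP.
Qed.
End LinearVectorField.

(** If q is in the kernel, then pairing it with the left eigenvector of index a
    gives a scalar polynomial that is an eigenvector of the derivation for
    D_a - c, a value that nonresonance excludes. As the left eigenvectors form
    a basis, q vanishes. *)
Lemma lker_op_shift_eq0 (K : fieldType) (d n c : nat) (L S : 'M[K]_d.+1)
    (D : 'rV[K]_d.+1) : S \in unitmx -> S *m L = diag_mx D *m S ->
  (forall (m : 'I_d.+1 -> nat) j,
     \sum_a (m a)%:R * D 0 a - D 0 j != - c%:R) ->
  lker (op_shift (lie_op n L) c) == 0%VS.
Proof.
move=> Su SL hres; apply/lker0P; apply: raddf_inj => q q0.
have hq i : lie_poly L q i + c%:R *: (q i : mpoly.mpoly d.+1 K) = 0.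
  have : (lie_op n L + c%:R *: \1)%VF q = 0 := q0.
  rewrite add_lfunE scale_lfunE id_lfunE lfunE.
  by move/ffunP => /(_ i) /(congr1 val); rewrite !ffunE.
pose p a := \sum_i S a i *: (q i : mpoly.mpoly d.+1 K).
have p0 a : p a = 0.
  apply: (@eigen_for_eq0 _ _ L S D (D 0 a - c%:R) _ Su SL) => [m|].
    have := hres m a; apply: contraNneq => ->.
    by rewrite addrAC subrr sub0r.
  rewrite /eigen_for scalerBl; apply/eqP; rewrite -subr_eq0 opprB addrA addrAC.
  apply/eqP.
  have -> : D 0 a *: p a =
      \sum_i S a i *: \sum_j L i j *: (q j : mpoly.mpoly d.+1 K).
    under [RHS]eq_bigr do rewrite scaler_sumr.
    rewrite exchange_big scaler_sumr; apply: eq_bigr => j _ /=.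
    under eq_bigr do rewrite scalerA.
    rewrite -scaler_suml scalerA; congr (_ *: _).
    by have /matrixP/(_ a j) := SL; rewrite mul_diag_mx !mxE => ->.
  rewrite /p linear_sum scaler_sumr -sumrB -big_split big1 //= => i _.
  rewrite linearZ /= scalerA mulrC -scalerA -scalerBr -scalerDr.
  by rewrite [X in _ *: X]hq scaler0.
apply/ffunP => i; apply: val_inj; rewrite ffunE /=.
have : \sum_a invmx S i a *: p a = 0.
  by rewrite big1 // => a _; rewrite p0 scaler0.
under eq_bigr do rewrite /p scaler_sumr.
rewrite exchange_big /=; under eq_bigr => j _.
  under eq_bigr do rewrite scalerA.
  rewrite -scaler_suml.
  over.
have e j : \sum_a invmx S i a * S a j = (i == j)%:R.
  have /matrixP/(_ i j) := mulVmx Su.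
  by rewrite !mxE.
rewrite (bigD1 i) //= e eqxx scale1r big1 ?addr0 // => j ji.
by rewrite e eq_sym (negPf ji) scale0r.
Qed.

(** * Derivatives of matrix expressions and of polynomials *)

Section Derivatives.
Variables (K : numFieldType).
Implicit Types (f g : K -> K) (t : K).

Lemma is_derive_bigsum (I : Type) (s : seq I) (f : I -> K -> K)
    (df : I -> K) t :
  (forall i, is_derive t 1 (f i) (df i)) ->
  is_derive t 1 (fun u => \sum_(i <- s) f i u) (\sum_(i <- s) df i).
Proof.
move=> h; elim: s => [|i s IH].
  rewrite big_nil; under eq_fun do rewrite big_nil; exact: is_derive_cst.
rewrite big_cons; under eq_fun do rewrite big_cons.
exact: is_deriveD.
Qed.

Lemma is_derive_mul f g df dg t :
  is_derive t 1 f df -> is_derive t 1 g dg ->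
  is_derive t 1 (fun u => f u * g u) (df * g t + f t * dg).
Proof.
move=> hf hg; have := is_deriveM hf hg; move/is_derive_eq; apply.
by rewrite addrC /GRing.scale /= [g t * _]mulrC.
Qed.

Lemma is_derive_exp f df t m : is_derive t 1 f df ->
  is_derive t 1 (fun u => f u ^+ m) (m%:R * f t ^+ m.-1 * df).
Proof.
by move=> hf; have := is_deriveX m hf; rewrite exprfctE.
Qed.

Lemma derivable_bigprod (I : Type) (s : seq I) (f : I -> K -> K) t :
  (forall i, derivable (f i) t 1) ->
  derivable (fun u => \prod_(i <- s) f i u) t 1.
Proof.
move=> h; elim: s => [|i s IH].
  under eq_fun do rewrite big_nil; exact: derivable_cst.
under eq_fun do rewrite big_cons.
exact: derivableM.
Qed.

Lemma derivable_bigsum (I : Type) (s : seq I) (f : I -> K -> K) t :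
  (forall i, derivable (f i) t 1) ->
  derivable (fun u => \sum_(i <- s) f i u) t 1.
Proof.
move=> h; have h' i : is_derive t 1 (f i) ('D_1 (f i) t) by exact: derivableP.
exact: (@ex_derive _ _ _ _ _ _ _ (is_derive_bigsum s h')).
Qed.

Lemma derivable_det n (M : K -> 'M[K]_n) t :
  (forall i j, derivable (fun u => M u i j) t 1) ->
  derivable (fun u => \det (M u)) t 1.
Proof.
move=> h; rewrite /determinant; apply: derivable_bigsum => s.
by apply: derivableM; [exact: derivable_cst | exact: derivable_bigprod].
Qed.

Lemma derivable_adj n (M : K -> 'M[K]_n) t i j :
  (forall i j, derivable (fun u => M u i j) t 1) ->
  derivable (fun u => (\adj (M u)) i j) t 1.
Proof.
move=> h; under eq_fun do rewrite mxE /cofactor.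
apply: derivableM; first exact: derivable_cst.
apply: derivable_det => a b.
by under eq_fun do rewrite !mxE; exact: h.
Qed.

(** Cramer's rule expresses the inverse through the determinant and the
    adjugate, which are polynomials in the entries. *)
Lemma derivable_invmx n (M : K -> 'M[K]_n) t i j :
  (forall i j, derivable (fun u => M u i j) t 1) ->
  (\forall u \near t, M u \in unitmx) ->
  derivable (fun u => invmx (M u) i j) t 1.
Proof.
move=> h uM.
have e : {near t, (fun u => (\det (M u))^-1 * (\adj (M u)) i j) =1
                  (fun u => invmx (M u) i j)}.
  by near=> u; rewrite /invmx ifT ?mxE //; near: u.
apply: near_eq_derivable e _.
apply: derivableM; last exact: derivable_adj.
apply: derivableV; last exact: derivable_det.
by rewrite -unitfE -unitmxE; exact: nbhs_singleton uM.
Unshelve. all: by end_near. Qed.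

Lemma is_derive_mulmx m n p (M : K -> 'M[K]_(m, n)) (N : K -> 'M[K]_(n, p))
    (dM : 'M[K]_(m, n)) (dN : 'M[K]_(n, p)) t i j :
  (forall i j, is_derive t 1 (fun u => M u i j) (dM i j)) ->
  (forall i j, is_derive t 1 (fun u => N u i j) (dN i j)) ->
  is_derive t 1 (fun u => (M u *m N u) i j) ((dM *m N t + M t *m dN) i j).
Proof.
move=> hM hN; under eq_fun do rewrite mxE.
rewrite !mxE -big_split /=; apply: is_derive_bigsum => l.
exact: is_derive_mul.
Qed.

(** Once the inverse is known to be differentiable, its derivative is found by
    differentiating M^-1 M = 1. *)
Lemma is_derive_invmx n (M : K -> 'M[K]_n) (dM : 'M[K]_n) t i j :
  (forall i j, is_derive t 1 (fun u => M u i j) (dM i j)) ->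
  (\forall u \near t, M u \in unitmx) ->
  is_derive t 1 (fun u => invmx (M u) i j)
    ((- (invmx (M t) *m dM *m invmx (M t))) i j).
Proof.
move=> hM uM.
have dI a b : derivable (fun u => invmx (M u) a b) t 1.
  by apply: derivable_invmx => // k l; have [] := hM k l.
pose dN : 'M[K]_n := \matrix_(a, b) 'D_1 (fun u => invmx (M u) a b) t.
have hN a b : is_derive t 1 (fun u => invmx (M u) a b) (dN a b).
  by rewrite mxE; exact: derivableP.
have ut : M t \in unitmx := nbhs_singleton uM.
suff -> : - (invmx (M t) *m dM *m invmx (M t)) = dN by [].
have : dN *m M t + invmx (M t) *m dM = 0.
  apply/matrixP => a b; rewrite [RHS]mxE.
  have h1 := is_derive_mulmx a b hN hM.
  have e : {near t, (fun=> (1%:M : 'M[K]_n) a b) =1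
                    (fun u => (invmx (M u) *m M u) a b)}.
    by near=> u; rewrite mulVmx //; near: u.
  have h0 : is_derive t 1 (fun=> (1%:M : 'M[K]_n) a b) (0 : K).
    exact: is_derive_cst.
  have h2 := near_eq_is_derive e h0.
  by rewrite -(@derive_val _ _ _ _ _ _ _ h1) (@derive_val _ _ _ _ _ _ _ h2).
move/eqP; rewrite addr_eq0 => /eqP /(congr1 (mulmx^~ (invmx (M t)))).
by rewrite /= mulmxK // mulNmx => ->.
Unshelve. all: by end_near. Qed.

(** The polynomials that satisfy the chain rule contain the constants and the
    variables and are closed under sums and products. *)
Lemma is_derive_meval n (p : mpoly.mpoly n K) (v : 'I_n -> K -> K)
    (dv : 'I_n -> K) t :
  (forall i, is_derive t 1 (v i) (dv i)) ->
  is_derive t 1 (fun u => mpoly.meval (fun i => v i u) p)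
   (\sum_i mpoly.meval (fun i => v i t) (mpoly.mderiv i p) * dv i).
Proof.
move=> hv.
(* The chain rule for q, as a predicate to be propagated. *)
pose ok (q : mpoly.mpoly n K) :=
  is_derive t 1 (fun u => mpoly.meval (fun i => v i u) q)
   (\sum_i mpoly.meval (fun i => v i t) (mpoly.mderiv i q) * dv i).
have okC c : ok (mpoly.mpolyC n c).
  rewrite /ok; under eq_fun do rewrite mpoly.mevalC.
  rewrite big1 => [|i _]; first exact: is_derive_cst.
  by rewrite mpoly.mderivC mpoly.meval0 mul0r.
have okX i : ok (mpoly.mpolyX K (mpoly.mnm1 i)).
  rewrite /ok; under eq_fun do rewrite mpoly.mevalXU.
  rewrite (bigD1 i) //= big1 ?addr0 => [|j ji].
    rewrite mpoly.mderivX mpoly.mnm1E eqxx scale1r.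
    have -> : mpoly.mnm_sub (mpoly.mnm1 i) (mpoly.mnm1 i) =
        mpoly.mnm0 :> mpoly.multinom n.
      by apply/mpoly.mnmP => l; rewrite mpoly.mnmBE mpoly.mnm0E subnn.
    by rewrite mpoly.mpolyX0 mpoly.meval1 mul1r.
  rewrite mpoly.mderivX mpoly.mnm1E eq_sym (negPf ji) scale0r.
  by rewrite mpoly.meval0 mul0r.
have okD q r : ok q -> ok r -> ok (q + r).
  move=> hq hr; rewrite /ok; under eq_fun do rewrite mpoly.mevalD.
  under eq_bigr do rewrite mpoly.mderivD mpoly.mevalD mulrDl.
  by rewrite big_split; exact: is_deriveD.
have okM q r : ok q -> ok r -> ok (q * r).
  move=> hq hr; rewrite /ok; under eq_fun do rewrite mpoly.mevalM.
  under eq_bigr do rewrite mpoly.mderivM mpoly.mevalD !mpoly.mevalM mulrDl.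
  have := is_derive_mul hq hr; rewrite mulr_suml mulr_sumr -big_split /=.
  move/is_derive_eq; apply; apply: eq_bigr => i _.
  by rewrite mulrAC mulrA.
have ok1 : ok 1 by rewrite -mpoly.mpolyC1; exact: okC.
suff : ok p by [].
apply: (@mpoly.mpolyind _ _ ok) => [|c m q _ _ IH].
  by rewrite -mpoly.mpolyC0; exact: okC.
apply: (okD) => //; rewrite -mpoly.mul_mpolyC; apply: (okM) => //.
rewrite mpoly.mpolyXE_id; apply: (big_ind ok ok1 okM) => i _.
by elim: (m i) => [|k IHk]; rewrite ?expr0 // exprS; apply: (okM).
Qed.
End Derivatives.

(** * The Rodrigues formula near a regular point *)

Section VectorPolynomials.
Variables (K : fieldType) (d n : nat).
Implicit Types (G : Pn K d n) (L : 'M[K]_d.+1) (v : 'cV[K]_d.+1).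

(** Bundled, so that the linear structure is not inferred anew at each use. *)
Definition lie_lin L : {linear Pn K d n -> Pn K d n} := @lie_fun K d n L.

Lemma pn_evalD G H v : pn_eval (G + H) v = pn_eval G v + pn_eval H v.
Proof. by apply/colP => i; rewrite !mxE ffunE /= mpoly.mevalD. Qed.

Lemma pn_evalZ c G v : pn_eval (c *: G) v = c *: pn_eval G v.
Proof. by apply/colP => i; rewrite !mxE ffunE /= mpoly.mevalZ. Qed.

Lemma lie_funM L1 L2 a b G :
  lie_fun (a *: L1 + b *: L2) G = a *: lie_fun L1 G + b *: lie_fun L2 G.
Proof.
have lf j :
    linform (a *: L1 + b *: L2) j = a *: linform L1 j + b *: linform L2 j.
  rewrite /linform !scaler_sumr -big_split; apply: eq_bigr => l _ /=.
  by rewrite !mxE scalerDl !scalerA.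
apply/ffunP => i; apply: val_inj; rewrite !ffunE /= /lie_poly.
rewrite !scalerBr !scaler_sumr addrACA -opprD -!big_split /=.
congr (_ - _); apply: eq_bigr => j _; last by rewrite !mxE scalerDl !scalerA.
by rewrite lf mulrDr !scalerAr.
Qed.

Lemma pn_eval_lie L G v i : (pn_eval (lie_fun L G) v) i 0 =
  \sum_j mpoly.meval (fun l => v l 0) (mpoly.mderiv j (G i)) * (L *m v) j 0
  - (L *m pn_eval G v) i 0.
Proof.
rewrite [LHS]mxE ffunE /= /lie_poly mpoly.mevalB.
congr (_ - _); rewrite raddf_sum /=.
  apply: eq_bigr => j _; rewrite mpoly.mevalM; congr (_ * _).
  rewrite /linform raddf_sum !mxE; apply: eq_bigr => l _ /=.
  by rewrite mpoly.mevalZ mpoly.mevalXU.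
by rewrite mxE; apply: eq_bigr => l _; rewrite mpoly.mevalZ !mxE.
Qed.
End VectorPolynomials.

Section Pullback.
Variables (K : numFieldType) (d n : nat).
Variables (Y : K -> 'M[K]_d.+1) (u : 'cV[K]_d.+1).
Implicit Types (G : Pn K d n) (M : 'M[K]_d.+1) (t : K) (i : 'I_d.+1).

(** Component i of G pulled back along the flow w = Y(s) u of the linear
    system; the Rodrigues formula differentiates such functions of s. *)
Definition pullback G i (s : K) : K :=
  (invmx (Y s) *m pn_eval G (Y s *m u)) i 0.

Lemma pullbackD G H i s :
  pullback (G + H) i s = pullback G i s + pullback H i s.
Proof. by rewrite /pullback pn_evalD mulmxDr mxE. Qed.

Lemma pullbackZ c G i s : pullback (c *: G) i s = c * pullback G i s.
Proof. by rewrite /pullback pn_evalZ -scalemxAr mxE. Qed.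

Lemma pullback_sum (I : Type) (s : seq I) (F : I -> Pn K d n) i t :
  pullback (\sum_(l <- s) F l) i t = \sum_(l <- s) pullback (F l) i t.
Proof.
elim: s => [|l s IH]; last by rewrite !big_cons pullbackD IH.
by rewrite !big_nil -(scale0r 0) pullbackZ mul0r.
Qed.

(** The derivative of Y^-1 contributes - M q, and the chain rule contributes
    dq M w: together they are the Lie action of M on q. *)
Lemma is_derive_pullback G M t i :
  (\forall s \near t, Y s \in unitmx) ->
  (forall a b, is_derive t 1 (fun s => Y s a b) ((M *m Y t) a b)) ->
  is_derive t 1 (pullback G i) (pullback (lie_fun M G) i t).
Proof.
move=> uY dY.
have dv j : is_derive t 1 (fun s => (Y s *m u) j 0) ((M *m (Y t *m u)) j 0).
  have du a b : is_derive t 1 (fun=> u a b) ((0 : 'cV[K]_d.+1) a b).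
    by rewrite mxE; exact: is_derive_cst.
  have := is_derive_mulmx j 0 dY du; move/is_derive_eq; apply.
  by rewrite mulmx0 addr0 mulmxA.
pose w : 'cV[K]_d.+1 := \col_i \sum_j
  mpoly.meval (fun l => (Y t *m u) l 0) (mpoly.mderiv j (G i)) *
    (M *m (Y t *m u)) j 0.
have dG a b : is_derive t 1 (fun s => pn_eval G (Y s *m u) a b) (w a b).
  rewrite ord1 !mxE; under eq_fun do rewrite mxE.
  exact: (is_derive_meval _ dv).
have dI a b := is_derive_invmx a b dY uY.
have := is_derive_mulmx i 0 dI dG; move/is_derive_eq; apply.
have ut : Y t \in unitmx := nbhs_singleton uY.
rewrite /pullback mulmxA mulmxK // mulNmx addrC -mulmxA -mulmxBr.
congr ((invmx (Y t) *m _) i 0).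
by apply/colP => a; rewrite pn_eval_lie !mxE.
Qed.

(** The identity nabla (Q^(m+1) F) = Q^m T_(m+1) F seen through the
    pullback. *)
Lemma is_derive_pullback_seq (F : nat -> Pn K d n) N m M L1 L2 t i :
  (\forall s \near t, Y s \in unitmx) ->
  (forall a b, is_derive t 1 (fun s => Y s a b) ((M *m Y t) a b)) ->
  (t ^+ 2 - 1) *: M = t *: L1 + L2 ->
  supp_below N.+1 F ->
  is_derive t 1
    (fun s => (s ^+ 2 - 1) ^+ m.+1 * pullback (ev_seq N.+1 F s) i s)
    ((t ^+ 2 - 1) ^+ m * pullback
       (ev_seq N.+2 (twisted_seq (lie_lin n L1) (lie_lin n L2) m.+1 F) t) i t).
Proof.
move=> uY dY eM sF.
have dQ : is_derive t (1 : K) (fun s : K => s ^+ 2 - 1) (2 * t).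
  have := is_deriveB (is_derive_exp 2 (is_derive_id t (1 : K)))
    (is_derive_cst (1 : K) t (1 : K)).
  by move/is_derive_eq; apply; rewrite subr0 mulr1 expr1.
have dQm := is_derive_exp m.+1 dQ.
have dF : is_derive t 1 (fun s => pullback (ev_seq N.+1 F s) i s)
    (pullback (ev_seq N (deriv_seq F) t + lie_fun M (ev_seq N.+1 F t)) i t).
  have e s : pullback (ev_seq N.+1 F s) i s =
             \sum_(l < N.+1) s ^+ l * pullback (F l) i s.
    by rewrite /ev_seq pullback_sum; apply: eq_bigr => l _; rewrite pullbackZ.
  under eq_fun do rewrite e.
  have dX l : is_derive t (1 : K) (fun s : K => s ^+ l) (l%:R * t ^+ l.-1).
    by rewrite -[X in is_derive _ _ _ X]mulr1; exact: is_derive_exp.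
  have := is_derive_bigsum (index_enum 'I_N.+1)
    (fun l : 'I_N.+1 =>
       is_derive_mul (dX l) (is_derive_pullback (F l) i uY dY)).
  move/is_derive_eq; apply.
  rewrite pullbackD big_split /=; congr (_ + _).
    rewrite big_ord_recl !mul0r add0r /ev_seq pullback_sum.
    apply: eq_bigr => l _; rewrite pullbackZ /deriv_seq /=.
    by rewrite -(scaler_nat _ (F _)) pullbackZ mulrCA mulrA.
  rewrite -[lie_fun M _]/(lie_lin n M (\sum_l _)) linear_sum pullback_sum.
  by apply: eq_bigr => l _; rewrite linearZ pullbackZ.
have := is_derive_mul dQm dF; move/is_derive_eq; apply.
set Qt := t ^+ 2 - 1; rewrite -/Qt.
rewrite /= (exprSr _ m) [m.+1%:R * _]mulrC -!mulrA -mulrDr; congr (_ * _).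
rewrite !mulrA -[m.+1%:R * 2]natrM.
rewrite {}/Qt (ev_twisted_seq _ _ _ _ sF) -!pullbackZ -pullbackD.
congr (pullback _ i t).
set e := ev_seq N.+1 F t.
rewrite scalerDr addrCA; congr (_ + _).
have -> : (t ^+ 2 - 1) *: lie_fun M e = t *: lie_fun L1 e + lie_fun L2 e.
  have := lie_funM L1 L2 t 1 e; rewrite !scale1r => <-.
  rewrite -eM; have := lie_funM M 0 (t ^+ 2 - 1) 0 e.
  by rewrite !scale0r !addr0.
rewrite addrA; congr (_ + _); rewrite scalerDr; congr (_ + _).
by rewrite -(scaler_nat _ e) scalerA mulrC mulnC.
Qed.
End Pullback.

(** Equality near x is equality near every point close to x, so it survives
    each differentiation. *)
Lemma near_eq_derive1n (K : numFieldType) (f g : K -> K) k (x : K) :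
  (\forall t \near x, f t = g t) ->
  \forall t \near x, derive1n k f t = derive1n k g t.
Proof.
elim: k => // k IH /IH /near_join fg.
near=> t; rewrite !derive1nS !derive1E; apply: near_eq_derive.
by near: t.
Unshelve. all: by end_near. Qed.

Lemma near_neq (K : numFieldType) (x a : K) :
  x != a -> \forall t \near x, t != a.
Proof.
rewrite -subr_eq0 => xa.
have : (fun t : K => t - a) @ x --> x - a.
  exact: cvgB cvg_id (cvg_cst a).
by move/cvgr_neq0 => /(_ xa); apply: filterS => t; rewrite subr_eq0.
Qed.

Section RodriguesFormula.
Variables (R : realType) (d n : nat) (A B : 'M[Cplx R]_d.+1).
Notation C := (Cplx R).
Variables (Y : C -> 'M[C]_d.+1) (u : 'cV[C]_d.+1).
Notation U := (rodrigues_seq (lie_lin n (A + B)) (lie_lin n (A - B))).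

(** Clearing denominators in M is what brings in A + B and A - B. *)
Lemma Mcoef_numerator (t : C) : t != 1 -> t != - 1 ->
  (t ^+ 2 - 1) *: Mcoef A B t = t *: (A + B) + (A - B).
Proof.
move=> t1 tN1; rewrite /Mcoef scalerDr !scalerA.
have -> : t ^+ 2 - 1 = (t - 1) * (t + 1) by rewrite -subr_sqr_1.
rewrite [(t - 1) * _ / _]mulrAC divff ?subr_eq0 // mul1r mulfK ?addr_eq0 //.
by rewrite scalerDl scalerBl !scale1r scalerDr addrACA.
Qed.

(** The Rodrigues formula: each differentiation trades one factor Q for one
    operator T_j. *)
Lemma derive1n_pullback k N (F : nat -> Pn C d n) (x : C) i :
  x != 1 -> x != - 1 -> fundamental_near A B x Y -> supp_below N.+1 F ->
  derive1n k (fun s => (s ^+ 2 - 1) ^+ k * pullback Y u (ev_seq N.+1 F s) i s) x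
  = pullback Y u (ev_seq (k + N).+1 (U k F) x) i x.
Proof.
move=> x1 xN1; elim: k N F => [|k IH] N F fY sF.
  by rewrite derive1n0 expr0 mul1r.
rewrite derive1Sn rodrigues_seqS addSnnS -[RHS]IH //; last first.
  exact: supp_twisted_seq.
apply: (nbhs_singleton (near_eq_derive1n k _)).
have fY' := near_join fY.
have nx1 := near_neq x1; have nxN1 := near_neq xN1.
near=> t; rewrite derive1E; apply: derive_val.
have ft : fundamental_near A B t Y by near: t.
apply: (@is_derive_pullback_seq _ _ _ Y u F N k (Mcoef A B t)).
- by apply: filterS ft => s [].
- by have [_] := nbhs_singleton ft.
- by apply: Mcoef_numerator; near: t.
- exact: sF.
Unshelve. all: by end_near. Qed.
End RodriguesFormula.

(** * The three-term recurrence *)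

Section OperatorFamily.
Variables (K : fieldType) (V : vectType K).
Implicit Types (D a b : 'End(V)) (F : nat -> 'End(V)).

Definition lcomp D a : 'End(V) := (D \o a)%VF.
Fact lcomp_is_linear D : linear (lcomp D).
Proof. by move=> c a b; rewrite /lcomp comp_lfunDr comp_lfunZr. Qed.
HB.instance Definition _ D :=
  GRing.isLinear.Build K _ _ _ (lcomp D) (lcomp_is_linear D).

Definition rcomp_seq a F : nat -> 'End(V) := fun i => (F i \o a)%VF.
Fact rcomp_seq_additive a : additive (rcomp_seq a).
Proof.
move=> F G; apply/funext => i.
by rewrite /rcomp_seq !fctE comp_lfunDl comp_lfunNl.
Qed.
HB.instance Definition _ a :=
  GRing.isZmodMorphism.Build _ _ (rcomp_seq a) (rcomp_seq_additive a).

Definition apply_seq (q : V) F : nat -> V := fun i => F i q.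
Fact apply_seq_additive q : additive (apply_seq q).
Proof.
move=> F G; apply/funext => i.
by rewrite /apply_seq !fctE add_lfunE opp_lfunE.
Qed.
HB.instance Definition _ q :=
  GRing.isZmodMorphism.Build _ _ (apply_seq q) (apply_seq_additive q).

Lemma ev_rcomp_seq N a F x :
  ev_seq N (rcomp_seq a F) x = (ev_seq N F x \o a)%VF.
Proof.
apply/lfunP => q; rewrite comp_lfunE /ev_seq !sum_lfunE.
by apply: eq_bigr => i _; rewrite !scale_lfunE comp_lfunE.
Qed.

Lemma ev_apply_seq N q F x : ev_seq N (apply_seq q F) x = ev_seq N F x q.
Proof.
by rewrite /ev_seq sum_lfunE; apply: eq_bigr => i _; rewrite scale_lfunE.
Qed.
End OperatorFamily.

Section Recurrence.
Variables (K : fieldType) (V : vectType K) (D1 D2 : 'End(V)).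
Notation E := 'End(V).
Notation X := (@shift_seq K E).
Notation U := (rodrigues_seq (lcomp D1) (lcomp D2)).
Notation one := (const_seq (\1%VF : E)).
Notation N := (op_shift D1).
Implicit Types (a : E) (F : nat -> E) (k : nat) (x : K).

Lemma rcomp_seq_shift a F : rcomp_seq a (X F) = X (rcomp_seq a F).
Proof. by apply/funext => -[|i]; rewrite /rcomp_seq //= comp_lfun0l. Qed.

Lemma rcomp_rodrigues_seq a k F :
  rcomp_seq a (U k F) = U k (rcomp_seq a F).
Proof.
rewrite /rodrigues_seq; apply: rodrigues_op_morph => {}F.
- exact: rcomp_seq_shift.
- apply/funext => i; rewrite /= /deriv_seq /rcomp_seq.
  by rewrite -scaler_nat -comp_lfunZl scaler_nat.
- by apply/funext => i; rewrite /= /rcomp_seq /map_seq /lcomp comp_lfunA.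
- by apply/funext => i; rewrite /= /rcomp_seq /map_seq /lcomp comp_lfunA.
Qed.

Lemma rcomp_one a : rcomp_seq a one = const_seq a.
Proof.
by apply/funext => -[|i]; rewrite /rcomp_seq /= ?comp_lfun1l ?comp_lfun0l.
Qed.

Lemma map_seq_one D : map_seq (lcomp D) one = rcomp_seq D one.
Proof. by rewrite map_const_seq rcomp_one /= /lcomp comp_lfun1r. Qed.

Lemma const_op_shift j :
  map_seq (lcomp D1) one + one *+ j = rcomp_seq (N j) one.
Proof.
rewrite map_seq_one !rcomp_one; apply/funext => i.
rewrite addrfctE natmulfctE /op_shift scaler_nat.
by case: i => [|i] //=; rewrite mul0rn addr0.
Qed.

Lemma rcomp_mulQ a F : rcomp_seq a (mulQ X F) = mulQ X (rcomp_seq a F).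
Proof. by rewrite /mulQ raddfB /= !rcomp_seq_shift. Qed.

(** The values at x of the polynomials P_k, R_k and S_k; their degrees
    are at most k, k+1 and k+2. *)
Definition rod k x : E := ev_seq k.+1 (U k one) x.
Definition rodX k x : E := ev_seq k.+2 (U k (X one)) x.
Definition rodQ k x : E := ev_seq k.+3 (U k (mulQ X one)) x.

Lemma supp_rod k : supp_below k.+1 (U k one).
Proof.
have := @supp_rodrigues_seq _ _ (lcomp D1) (lcomp D2) 0 k one.
by rewrite addn0; apply; exact: supp_const.
Qed.

Lemma supp_rodX k : supp_below k.+2 (U k (X one)).
Proof.
have := @supp_rodrigues_seq _ _ (lcomp D1) (lcomp D2) 1 k (X one).
by rewrite addn1; apply; apply: supp_shift; exact: supp_const.
Qed.

(** T_(k+1) maps the constant 1 to x N_(2k+2) + D2. *)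
Lemma rodS k x : rod k.+1 x =
  (rodX k x \o N (2 * k.+1))%VF + (rod k x \o D2)%VF.
Proof.
rewrite /rod rodrigues_seqS /twisted_seq twisted_deriv_const; last first.
  exact: deriv_const_seq.
rewrite /= const_op_shift map_seq_one -rcomp_seq_shift raddfD /=.
rewrite -!rcomp_rodrigues_seq.
rewrite ev_seqD !ev_rcomp_seq; congr (_ + (_ \o _)%VF).
by apply: ev_seq_widen; [exact: supp_rod | exact: leqnSn].
Qed.

(** T_(k+1) maps x to Q N_(2k+3) + N_(2k+2) + x D2. *)
Lemma rodXS k x : rodX k.+1 x =
  (rodQ k x \o N (2 * k.+1).+1)%VF + (rod k x \o N (2 * k.+1))%VF
  + (rodX k x \o D2)%VF.
Proof.
rewrite /rodX rodrigues_seqS /twisted_seq twisted_deriv_Xconst /=; first last.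
- exact: deriv_const_seq.
- by move=> F; rewrite map_shift_seq.
- by move=> F; rewrite map_shift_seq.
- exact: deriv_shift_seq.
rewrite !const_op_shift map_seq_one -rcomp_seq_shift -rcomp_mulQ.
rewrite !(raddfD (U k)) /= -!rcomp_rodrigues_seq.
rewrite !ev_seqD !ev_rcomp_seq; congr (_ + _ + _); congr (_ \o _)%VF.
  by apply: ev_seq_widen; [exact: supp_rod | exact/leqW/leqnSn].
by apply: ev_seq_widen; [exact: supp_rodX | exact: leqnSn].
Qed.

Lemma rodX_mulX k x : rodX k.+1 x = x *: rod k.+1 x + rodQ k x *+ k.+1.
Proof.
rewrite /rodX /rodrigues_seq rodrigues_opX //; first last.
- by move=> F; rewrite /= map_shift_seq.
- by move=> F; rewrite /= map_shift_seq.
- exact: deriv_shift_seq.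
by rewrite ev_seqD ev_seqMn ev_seq_shift.
Qed.

Lemma rodX0 x : rodX 0 x = x *: rod 0 x.
Proof. by rewrite /rodX /= ev_seq_shift. Qed.

Hypothesis N_inj : forall c, lker (N c.+1) == 0%VS.

Let comp_lfunMnr (f g : E) m : (f \o (g *+ m) = (f \o g) *+ m)%VF.
Proof. by rewrite -!(scaler_nat m) comp_lfunZr. Qed.

Lemma op_shift_comm i j : (N i \o N j = N j \o N i)%VF.
Proof.
rewrite /op_shift !comp_lfunDl !comp_lfunDr -!comp_lfunZl -!comp_lfunZr.
rewrite !comp_lfun1l !comp_lfun1r -!addrA; congr (_ + _).
by rewrite addrCA !scalerA mulrC.
Qed.

Lemma op_shift_inv_comm i j :
  ((N i.+1)^-1 \o (N j.+1)^-1 = (N j.+1)^-1 \o (N i.+1)^-1)%VF.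
Proof.
have fgY : (N i.+1 \o N j.+1 \o ((N j.+1)^-1 \o (N i.+1)^-1) = \1)%VF.
  by rewrite -comp_lfunA (lker0_compVKf (N_inj _)) (lker0_compfV (N_inj _)).
rewrite -[LHS]comp_lfun1r -fgY op_shift_comm -!comp_lfunA.
by rewrite !(lker0_compKf (N_inj _)).
Qed.

Lemma rodX_solve k x : rodX k x =
  ((rod k.+1 x - (rod k x \o D2)%VF) \o (N (2 * k.+1))^-1)%VF.
Proof. by rewrite rodS addrK mulnS (lker0_compfK (N_inj _)). Qed.

(** In x P_(k+1) = R_(k+1) - (k+1) S_k, the relation rodXS is solved for S_k and
    rodS for R_k and R_(k+1), which leaves P_(k+2), P_(k+1) and P_k. The
    recursion starts with x P_0 = R_0. *)
Lemma rod_recurrence k : exists alpha beta gamma : 'End(V),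
  alpha = ((N (2 * k + 1)%N)^-1 \o ((N (2 * k + 2)%N)^-1 \o N k.+1))%VF /\
  forall x, x *: rod k x =
    (rod k.+1 x \o alpha)%VF + (rod k x \o beta)%VF
    + (if k is k'.+1 then (rod k' x \o gamma)%VF else 0).
Proof.
pose al := ((N (2 * k + 1)%N)^-1 \o ((N (2 * k + 2)%N)^-1 \o N k.+1))%VF.
exists al.
pose I1 := (N (2 * k).+1)^-1%VF.
(* 1 - k / N_(2k+1) = N_(k+1) / N_(2k+1). *)
have alE : al = ((N (2 * k.+1))^-1 \o (\1 - I1 *+ k))%VF.
  have -> : (\1 - I1 *+ k)%VF = (I1 \o N k.+1)%VF.
    have -> : N k.+1 = N (2 * k).+1 - k%:R *: \1%VF.
      rewrite /op_shift -addrA -scalerBl; congr (_ + _ *: _).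
      by rewrite mul2n -addnn -addSn natrD addrK.
    rewrite comp_lfunDr (lker0_compVf (N_inj _)) comp_lfunNr -comp_lfunZr.
    by rewrite comp_lfun1r scaler_nat.
  rewrite /al addn1 comp_lfunA mulnS addnC op_shift_inv_comm.
  by rewrite comp_lfunA.
case: k @al @I1 alE => [|k] al J alE.
  exists (- (D2 \o al))%VF, 0; split=> // x.
  rewrite addr0 -rodX0 rodX_solve alE mulr0n subr0 comp_lfun1r.
  by rewrite comp_lfunDl comp_lfunNl comp_lfunNr comp_lfunA.
pose J' := (N (2 * k.+1))^-1%VF.
exists ((J' \o D2 \o J) *+ k.+1 - (D2 \o al))%VF.
exists (((N (2 * k.+1) - (D2 \o J' \o D2)) \o J) *+ k.+1)%VF.
split=> // x.
have rodQE : rodQ k x = ((rodX k.+1 x -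
    ((rod k x \o N (2 * k.+1)) + (rodX k x \o D2))) \o J)%VF.
  by rewrite rodXS -(addrA (_ \o _)%VF) addrK (lker0_compfK (N_inj _)).
have -> : x *: rod k.+1 x = (rodX k.+1 x \o (\1 - J *+ k.+1))%VF
    + ((((rod k x \o N (2 * k.+1)) + (rodX k x \o D2)) \o J) *+ k.+1)%VF.
  rewrite -[LHS](addrK (rodQ k x *+ k.+1)) -rodX_mulX rodQE.
  rewrite comp_lfunDl comp_lfunNl mulrnBl opprB addrA addrAC.
  by rewrite comp_lfunDr comp_lfun1r comp_lfunNr comp_lfunMnr.
have -> : (rodX k.+1 x \o (\1 - J *+ k.+1))%VF =
    ((rod k.+2 x \o al) - (rod k.+1 x \o (D2 \o al)))%VF.
  by rewrite rodX_solve -comp_lfunA -alE comp_lfunDl comp_lfunNl -comp_lfunA.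
have -> : (((rod k x \o N (2 * k.+1)) + (rodX k x \o D2)) \o J)%VF =
    (rod k.+1 x \o (J' \o D2 \o J))%VF +
    (rod k x \o ((N (2 * k.+1) - (D2 \o J' \o D2)) \o J))%VF.
  rewrite rodX_solve -/J'; clearbody J'; move: (N (2 * k.+1)) => M.
  rewrite !comp_lfunDl !comp_lfunNl !comp_lfunDr !comp_lfunNr.
  by rewrite !comp_lfunA addrCA.
rewrite mulrnDl -!comp_lfunMnr comp_lfunDr comp_lfunNr -!addrA.
by congr (_ + _); rewrite [LHS]addrCA.
Qed.
End Recurrence.

(** * The Rodrigues family and its recurrence *)

Lemma apply_rodrigues_seq (K : fieldType) (d n : nat) (L1 L2 : 'M[K]_d.+1)
    (q : Pn K d n) k (F : nat -> 'End(Pn K d n)) :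
  apply_seq q (rodrigues_seq (lcomp (lie_op n L1)) (lcomp (lie_op n L2)) k F) =
  rodrigues_seq (lie_lin n L1) (lie_lin n L2) k (apply_seq q F).
Proof.
rewrite /rodrigues_seq; apply: rodrigues_op_morph => {}F.
- by apply/funext => -[|i]; rewrite /= /apply_seq /= ?zero_lfunE.
- apply/funext => i; rewrite /= /deriv_seq /apply_seq.
  by rewrite -scaler_nat scale_lfunE scaler_nat.
- apply/funext => i; rewrite /= /apply_seq /map_seq /= /lcomp comp_lfunE.
  by rewrite lfunE.
- apply/funext => i; rewrite /= /apply_seq /map_seq /= /lcomp comp_lfunE.
  by rewrite lfunE.
Qed.

Lemma rod_polynomial (K : fieldType) (V : vectType K) (D1 D2 : 'End(V)) k :
  polynomial_in (rod D1 D2 k).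
Proof.
pose F := rodrigues_seq (lcomp D1) (lcomp D2) k (const_seq (\1%VF : 'End(V))).
exists (mkseq F k.+1) => x; rewrite size_mkseq; apply: eq_bigr => i _.
by rewrite nth_mkseq.
Qed.

Lemma rod_is_rodrigues_family (R : realType) (d n : nat)
    (A B : 'M[Cplx R]_d.+1) :
  is_rodrigues_family A B (rod (lie_op n (A + B)) (lie_op n (A - B))).
Proof.
move=> k; split; first exact: rod_polynomial.
move=> x Y x1 xN1 fY q w.
have Yx : Y x \in unitmx by have [] := nbhs_singleton fY.
pose u := invmx (Y x) *m w.
have Fq : rod (lie_op n (A + B)) (lie_op n (A - B)) k x q =
    ev_seq k.+1 (rodrigues_seq (lie_lin n (A + B)) (lie_lin n (A - B))
      k (const_seq q)) x.
  rewrite /rod -ev_apply_seq apply_rodrigues_seq; congr ev_seq.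
  congr rodrigues_seq; apply/funext => -[|i]; rewrite /apply_seq /=.
    by rewrite id_lfunE.
  by rewrite zero_lfunE.
rewrite /rodrigues [X in Y x *m X](_ : _ =
    invmx (Y x) *m pn_eval (rod (lie_op n (A + B)) (lie_op n (A - B)) k x q)
      (Y x *m u)).
  by rewrite !mulmxA !mulmxV // !mul1mx.
apply/colP => i; rewrite mxE.
transitivity (derive1n k (fun s => (s ^+ 2 - 1) ^+ k *
    pullback Y u (ev_seq 1 (const_seq q) s) i s) x).
  congr (derive1n k _ x); apply/funext => s.
  by rewrite ev_seq_const /pullback mxE mulmxA.
have h := derive1n_pullback u k i x1 xN1 fY (@supp_const _ _ q).
by rewrite Fq; move: h; rewrite addn0.
Qed.

(** Row a of S is a left eigenvector, so D_a is a root of the characteristic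
    polynomial. Membership in the list of eigenvalues suffices to transfer
    nonresonance, since exponents can be moved along any map of indices. *)
Lemma diagonalized_eigenvalue (K : fieldType) (d : nat) (L S : 'M[K]_d.+1)
    (D : 'rV[K]_d.+1) (lam : 'I_d.+1 -> K) a :
  S \in unitmx -> S *m L = diag_mx D *m S ->
  char_poly L = \prod_i ('X - (lam i)%:P) -> exists i, D 0 a = lam i.
Proof.
move=> Su SL cL.
have : eigenvalue L (D 0 a).
  apply/eigenvalueP; exists (row a S).
    by rewrite -row_mul SL; apply/rowP => j; rewrite mul_diag_mx !mxE.
  apply: contraTneq Su => r0; rewrite -row_free_unit; apply/negP => Sf.
  move: r0; rewrite rowE -(mul0mx _ S) => /(row_free_inj Sf) /matrixP/(_ 0 a).
  by rewrite !mxE !eqxx => /eqP; rewrite oner_eq0.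
rewrite eigenvalue_root_char cL /root horner_prod => /prodf_eq0 [i _].
by rewrite hornerXsubC subr_eq0 => /eqP; exists i.
Qed.

Theorem proposition2 (R : realType) (d n : nat) (A B : 'M[Cplx R]_d.+1)
    (lam : 'I_d.+1 -> Cplx R)
    (hdiag : diagonalizable (A + B))
    (hlam : char_poly (A + B) = \prod_i ('X - (lam i)%:P))
    (hres : nonresonant lam) :
  exists P : nat -> Cplx R -> 'End(Pn (Cplx R) d n),
    is_rodrigues_family A B P /\
    forall k : nat,
      let D1 : 'End(Pn (Cplx R) d n) := lie_op n (A + B) in
      [/\ lker (op_shift D1 (2 * k + 1)%N) == 0%VS,
          lker (op_shift D1 (2 * k + 2)%N) == 0%VS
        & exists alpha beta gamma : 'End(Pn (Cplx R) d n),
            alpha = ((op_shift D1 (2 * k + 1)%N)^-1 \o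
                     ((op_shift D1 (2 * k + 2)%N)^-1 \o op_shift D1 k.+1))%VF /\
            forall x : Cplx R,
              x *: P k x = (P k.+1 x \o alpha)%VF + (P k x \o beta)%VF
                + (if k is k'.+1 then (P k' x \o gamma)%VF else 0)].
Proof.
have [S Su /diagonalizable_forPex [D /(simmxP Su) SL]] := hdiag.
have /choice [f fE] : forall a, exists i, D 0 a = lam i.
  by move=> a; exact: diagonalized_eigenvalue Su SL hlam.
have inj c : lker (op_shift (lie_op n (A + B)) c.+1) == 0%VS.
  apply: lker_op_shift_eq0 Su SL _ => m j.
  (* Exponents are summed over the fibres of f: the eigenvalues D a that equal
     lam i share one exponent there. *)
  have := hres (fun i => \sum_(a | f a == i) m a)%N (f j) (- c.+1%:Z) isT.
  rewrite -fE mulrNz.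
  suff -> : \sum_i (\sum_(a | f a == i) m a)%:R * lam i =
            \sum_a (m a)%:R * D 0 a by [].
  rewrite [RHS](partition_big f xpredT) //=; apply: eq_bigr => i _.
  rewrite natr_sum mulr_suml; apply: eq_bigr => a /eqP <-.
  by rewrite fE.
exists (rod (lie_op n (A + B)) (lie_op n (A - B))).
split; first exact: rod_is_rodrigues_family.
move=> k; split; [by rewrite addn1 | by rewrite addn2 |].
exact: rod_recurrence.
Qed.
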